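(* For every integer $t\ge 1$ with $t\ne 3,6$, there exists a $(6t,3,2)$-BIBD with an optimal weak nesting; specifically, it has a weak nesting $\phi:\mathcal{A}\to Y$ with $|Y|=7t$, and no weak nesting of a $(6t,3,2)$-BIBD has fewer than $7t$ points.
   Context: A $(v,k,\lambda)$-BIBD is a pair $(X,\mathcal{A})$ where $X$ is a set of $v$ points and $\mathcal{A}$ is a multiset of $k$-subsets of $X$ (blocks) such that every pair of distinct points lies in exactly $\lambda$ blocks. A partial $(w,k,\lambda)$-BIBD is defined in the same way on $w$ points, except that every pair lies in at most $\lambda$ blocks. Given a $(v,k,\lambda)$-BIBD $(X,\mathcal{A})$ and a set $Y\supseteq X$ with $|Y|=w$, a map $\phi:\mathcal{A}\to Y$ is a weak nesting if $\phi(A)\notin A$ for every block $A$ and the multiset $\{A\cup\{\phi(A)\}:A\in\mathcal{A}\}$ is a partial $(w,k+1,\lambda+1)$-BIBD on $Y$. A weak nesting is optimal if $w=|Y|$ is as small as possible. *)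

(* Defs.v *)
From mathcomp Require Import all_boot.
Set Implicit Arguments. Unset Strict Implicit. Unset Printing Implicit Defensive.

(* A multiset of blocks is represented as an indexed family B : 'I_b -> {set T}
   (repeated blocks allowed). Points live in a finite type T. *)

Definition pair_count (T : finType) (b : nat) (B : 'I_b -> {set T}) (x y : T) : nat :=
  #|[set i : 'I_b | (x \in B i) && (y \in B i)]|.

Definition is_BIBD (T : finType) (X : {set T}) (v k lam : nat)
    (b : nat) (B : 'I_b -> {set T}) : Prop :=
  [/\ #|X| = v,
      (forall i, B i \subset X /\ #|B i| = k) &
      (forall x y, x \in X -> y \in X -> x != y -> pair_count B x y = lam)].

Definition is_partial_BIBD (T : finType) (Y : {set T}) (w k lam : nat)
    (b : nat) (B : 'I_b -> {set T}) : Prop :=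
  [/\ #|Y| = w,
      (forall i, B i \subset Y /\ #|B i| = k) &
      (forall x y, x \in Y -> y \in Y -> x != y -> pair_count B x y <= lam)].

Definition weak_nesting (T : finType) (X Y : {set T}) (k lam : nat)
    (b : nat) (B : 'I_b -> {set T}) (phi : 'I_b -> T) : Prop :=
  [/\ X \subset Y,
      (forall i, phi i \in Y),
      (forall i, phi i \notin B i) &
      is_partial_BIBD Y #|Y| k.+1 lam.+1 (fun i => B i :|: [set phi i])].

(* Main.v *)
(** Lower bound: the pairs inside [X] can absorb at most one extra edge each, so at most half
    of the [2t(6t-1)] blocks are nested in [X]; each of the others uses three edges between [X]
    and [Y \ X], and every such pair carries at most three, whence [6t-1 <= 6(|Y| - 6t)].

    Existence: write [t = t0 s] with [t0] in {1, 2, 3, 6} and [s] the order of a self-orthogonal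
    latin square [L] (orders 4, 9 and all those coprime to 6, closed under products).  The points
    are [S x Z_g] with [g = 6 t0] and the new points are [S x t0].  Inside each group [{u} x Z_g]
    we copy a design for [t0], obtained from a 1-rotational one over [Z_(6 t0 - 1)] and a fixed
    point: there each of the [t0] new points nests one full orbit of triples, which misses the
    fixed point and meets every other point exactly three times.  For the pairs across groups,
    each unordered pair [{i, j}] yields the quadruple [(i, j, L i j, L j i)], on which a fixed
    family of blocks is developed modulo [g].  Self-orthogonality says that the position pairs
    02 and 13, 20 and 31, 03 and 12, 30 and 21, 01 and 10, 23 and 32 of the quadruples
    jointly cover every ordered pair of groups once, so the covering conditions reduce to counting differences.  The base blocks come from a
    computer search. *)

Require Import Defs.
From HB Require Import structures.
From mathcomp Require Import all_boot.
From mathcomp Require Import ssralg finalg zmodp.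
From mathcomp Require Import zify ring.
Set Implicit Arguments. Unset Strict Implicit. Unset Printing Implicit Defensive.

(** * Nested systems and their development *)

(* [(a, b, c, d)] is the block [{a, b, c}] nested at [d], a point of [X] or a new one of [W]. *)
Definition quad (X W : Type) : Type := (X * X * X * (X + W))%type.

Definition leaves X W (q : quad X W) : seq X := [:: q.1.1.1; q.1.1.2; q.1.2].

Definition leaf_pairs X W (q : quad X W) : seq (X * X) :=
  let: (a, b, c, _) := q in [:: (a, b); (b, a); (a, c); (c, a); (b, c); (c, b)].

Definition inner_arcs X W (q : quad X W) : seq (X * X) :=
  if q.2 is inl y then [seq (x, y) | x <- leaves q] else [::].

Definition outer_arcs X W (q : quad X W) : seq (X * W) :=
  if q.2 is inr w then [seq (x, w) | x <- leaves q] else [::].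

Definition all_leaf_pairs X W (s : seq (quad X W)) := flatten (map (@leaf_pairs X W) s).
Definition all_inner_arcs X W (s : seq (quad X W)) := flatten (map (@inner_arcs X W) s).
Definition all_outer_arcs X W (s : seq (quad X W)) := flatten (map (@outer_arcs X W) s).

Definition wf_quad (X : eqType) W (q : quad X W) : bool :=
  uniq (leaves q) && (if q.2 is inl y then y \notin leaves q else true).

(** [leaf_pairs] lists both orders, so the exact count is lambda = 2, whereas arcs are directed
    towards the nesting point and both directions are added. The bounds 1 and 3 keep every pair at
    most lambda + 1 = 3 times in augmented blocks; no augmented block has two new points. *)
Record nested_system (X W : eqType) (s : seq (quad X W)) : Prop := NestedSystem {
  nested_wf : all (@wf_quad X W) s;
  nested_pairs : forall x y, x != y -> count_mem (x, y) (all_leaf_pairs s) = 2;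
  nested_inner : forall x y, x != y ->
    count_mem (x, y) (all_inner_arcs s) + count_mem (y, x) (all_inner_arcs s) <= 1;
  nested_outer : forall x w, count_mem (x, w) (all_outer_arcs s) <= 3 }.

Definition map_quad X W X' W' (f : X -> X') (g : W -> W') (q : quad X W) : quad X' W' :=
  let: (a, b, c, d) := q in
  (f a, f b, f c, match d with inl x => inl (f x) | inr w => inr (g w) end).

Definition develop K X W X' W' (f : K -> X -> X') (g : K -> W -> W')
    (ks : seq K) (s : seq (quad X W)) : seq (quad X' W') :=
  flatten [seq map (map_quad (f k) (g k)) s | k <- ks].

Lemma count_sum T (a : pred T) (s : seq T) : count a s = \sum_(x <- s) a x.
Proof. by elim: s => [|x s IH] /=; rewrite ?big_nil // big_cons IH. Qed.

Lemma count_flatten_map T U (a : pred U) (F : T -> seq U) (s : seq T) :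
  count a (flatten (map F s)) = \sum_(x <- s) count a (F x).
Proof. by rewrite count_flatten sumnE -map_comp big_map. Qed.

Section Develop.
Variables (K : Type) (X W : Type) (X' W' : eqType).
Variables (f : K -> X -> X') (g : K -> W -> W') (ks : seq K) (s : seq (quad X W)).

Lemma leaf_pairs_develop e : count_mem e (all_leaf_pairs (develop f g ks s)) =
  \sum_(k <- ks) \sum_(p <- all_leaf_pairs s) ((f k p.1, f k p.2) == e).
Proof.
elim: ks => [|k ks' IH]; first by rewrite big_nil.
rewrite /develop /all_leaf_pairs /= map_cat flatten_cat count_cat big_cons -IH.
congr (_ + _); rewrite -count_sum -(count_map (fun p => (f k p.1, f k p.2)) (pred1 e)).
rewrite map_flatten -!map_comp; congr (count _ (flatten _)).
by apply: eq_map => [[[[a b] c] d]].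
Qed.

Lemma inner_arcs_develop e : count_mem e (all_inner_arcs (develop f g ks s)) =
  \sum_(k <- ks) \sum_(p <- all_inner_arcs s) ((f k p.1, f k p.2) == e).
Proof.
elim: ks => [|k ks' IH]; first by rewrite big_nil.
rewrite /develop /all_inner_arcs /= map_cat flatten_cat count_cat big_cons -IH.
congr (_ + _); rewrite -count_sum -(count_map (fun p => (f k p.1, f k p.2)) (pred1 e)).
rewrite map_flatten -!map_comp; congr (count _ (flatten _)).
by apply: eq_map => [[[[a b] c] [d|d]]].
Qed.

Lemma outer_arcs_develop e : count_mem e (all_outer_arcs (develop f g ks s)) =
  \sum_(k <- ks) \sum_(p <- all_outer_arcs s) ((f k p.1, g k p.2) == e).
Proof.
elim: ks => [|k ks' IH]; first by rewrite big_nil.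
rewrite /develop /all_outer_arcs /= map_cat flatten_cat count_cat big_cons -IH.
congr (_ + _); rewrite -count_sum -(count_map (fun p => (f k p.1, g k p.2)) (pred1 e)).
rewrite map_flatten -!map_comp; congr (count _ (flatten _)).
by apply: eq_map => [[[[a b] c] [d|d]]].
Qed.

End Develop.

Definition entries X W (q : quad X W) : seq X :=
  leaves q ++ (if q.2 is inl y then [:: y] else [::]).

Lemma wf_quadE (X : eqType) W (q : quad X W) : wf_quad q = uniq (entries q).
Proof.
by case: q => [[[a b] c] [y|w]]; rewrite /wf_quad /entries cat_uniq //= ?orbF ?andbT.
Qed.

Lemma entries_map X W X' W' (f : X -> X') (g : W -> W') q :
  entries (map_quad f g q) = map f (entries q).
Proof. by case: q => [[[a b] c] [y|w]]. Qed.

(* [h] is a computable invariant of [f k]. *)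
Lemma wf_develop (K X Y X' : eqType) W W' (A : pred X) (h : X -> Y)
    (f : K -> X -> X') (g : K -> W -> W') (ks : seq K) (s : seq (quad X W)) :
  (forall k, k \in ks -> {in A &, forall x y, f k x = f k y -> h x = h y}) ->
  all (fun q => all A (entries q) && uniq (map h (entries q))) s ->
  all (@wf_quad X' W') (develop f g ks s).
Proof.
move=> + wf; elim: ks => //= k ks IH fh.
rewrite all_cat {}IH ?andbT => [|k' kks]; last by apply: fh; rewrite inE kks orbT.
rewrite all_map.
apply: sub_all wf => q /andP[/allP qA Uq] /=.
rewrite wf_quadE entries_map map_inj_in_uniq ?(map_uniq Uq) // => x y qx qy.
move/(fh k (mem_head _ _) _ _ (qA x qx) (qA y qy)) => hxy.
(* [h] is injective on a list whose image under [h] has no repetition, by induction on that list. *)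
move: qx qy hxy Uq; elim: (entries q) => //= z e IHe; rewrite !inE.
by case/predU1P=> [->|ex] /predU1P[->|ey] // exy /andP[];
  [rewrite exy | rewrite -exy | move=> _; exact: IHe]; rewrite map_f.
Qed.

Lemma all_leaf_pairs_cat X W (s1 s2 : seq (quad X W)) :
  all_leaf_pairs (s1 ++ s2) = all_leaf_pairs s1 ++ all_leaf_pairs s2.
Proof. by rewrite /all_leaf_pairs map_cat flatten_cat. Qed.

Lemma all_inner_arcs_cat X W (s1 s2 : seq (quad X W)) :
  all_inner_arcs (s1 ++ s2) = all_inner_arcs s1 ++ all_inner_arcs s2.
Proof. by rewrite /all_inner_arcs map_cat flatten_cat. Qed.

Lemma all_outer_arcs_cat X W (s1 s2 : seq (quad X W)) :
  all_outer_arcs (s1 ++ s2) = all_outer_arcs s1 ++ all_outer_arcs s2.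
Proof. by rewrite /all_outer_arcs map_cat flatten_cat. Qed.

(** A renaming of points is a development with one parameter, so the counting lemmas above apply to
    it. *)
Lemma develop_unit X W X' W' (f : X -> X') (g : W -> W') (s : seq (quad X W)) :
  develop (fun=> f) (fun=> g) [:: tt] s = map (map_quad f g) s.
Proof. by rewrite /develop /= cats0. Qed.

Lemma nested_system_transfer (X X' W W' : eqType) (f : X -> X') (g : W -> W')
    (s : seq (quad X W)) :
  bijective f -> bijective g -> nested_system s ->
  nested_system (map (map_quad f g) s).
Proof.
move=> [f' fK f'K] [g' gK g'K] [wf prs inn out]; rewrite -develop_unit.
have fi := can_inj fK; have gi := can_inj gK.
have sumE (s' : seq (X * X)) x y :
    \sum_(p <- s') ((f p.1, f p.2) == (x, y)) = count_mem (f' x, f' y) s'.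
  rewrite count_sum; apply: eq_bigr => -[a b] _ /=.
  by rewrite !xpair_eqE !(can2_eq fK f'K).
have neq x y : x != y -> f' x != f' y by rewrite (can_eq f'K).
split=> [|x y xy|x y xy|x w].
- apply: (wf_develop (A := predT) (h := id)) => [k _ x y _ _ /fi //|].
  by apply: sub_all wf => q; rewrite wf_quadE map_id all_predT.
- by rewrite leaf_pairs_develop big_seq1 sumE prs ?neq.
- by rewrite !inner_arcs_develop !big_seq1 !sumE inn ?neq.
- rewrite outer_arcs_develop big_seq1; apply: leq_trans (out (f' x) (g' w)).
  rewrite count_sum leq_sum // => -[a b] _ /=.
  by rewrite !xpair_eqE (can2_eq fK f'K) (can2_eq gK g'K).
Qed.
(** * Translates of base blocks *)

Section Translations.
Variables (n : nat) (n_gt1 : 1 < n).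
Implicit Types x y : 'Z_n.
Import GRing.Theory.

Lemma sum_translation a x : \sum_(k : 'Z_n) ((a%:R + k)%R == x) = 1.
Proof.
rewrite (bigD1 (x - a%:R)%R) //= addrC subrK eqxx big1 // => k; rewrite eq_sym => kx.
by rewrite addrC eq_sym -subr_eq (negPf kx).
Qed.

(** Only [k = x - a] sends [a] to [x], and it sends [b] to [y] exactly when the differences agree.
    The congruence is kept in [nat] so that the tests on base blocks compute. *)
Lemma sum_translation2 a b x y :
  \sum_(k : 'Z_n) (((a%:R + k)%R == x) && ((b%:R + k)%R == y)) =
  ((y - x)%R + a == b %[mod n]) :> nat.
Proof.
rewrite (bigD1 (x - a%:R)%R) //= addrC subrK eqxx /= big1 ?addn0 => [|k kx]; last first.
  by rewrite addrC [X in X && _]eq_sym -subr_eq eq_sym (negPf kx).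
congr (nat_of_bool _).
transitivity ((((y - x)%R + a)%:R : 'Z_n)%R == (b%:R)%R).
  rewrite natrD natr_Zp -[RHS](inj_eq (addIr (x - a%:R)%R)).
  by rewrite addrACA subrK addrN addr0 eq_sym.
have valE m : val (m%:R : 'Z_n)%R = m %% n by exact: val_Zp_nat.
by rewrite -val_eqE; congr (_ == _); exact: valE.
Qed.

Lemma Zp_lt x : x < n.
Proof. by have := ltn_ord x; rewrite [X in _ < X -> _]Zp_cast. Qed.

Lemma Zp_sub_range x y : x != y -> ((y - x)%R : nat) \in iota 1 n.-1.
Proof.
move=> xy; rewrite mem_iota add1n prednK ?(ltnW n_gt1) // Zp_lt andbT lt0n.
by apply: contra xy => /eqP dE; rewrite eq_sym -subr_eq0; apply/eqP/val_inj.
Qed.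

(** Both sides count the translations that send [a] to [y] and [b] to [x]. *)
Lemma Zp_sub_swap a b x y :
  ((x - y)%R + a == b %[mod n]) = ((y - x)%R + b == a %[mod n]).
Proof.
have nbI : injective nat_of_bool by do 2!case.
apply: nbI.
by rewrite -!sum_translation2; apply: eq_bigr => k _; rewrite andbC.
Qed.

End Translations.

Definition swap T (e : T * T) : T * T := (e.2, e.1).

Definition diff_count n d (s : seq (option nat * option nat)) : nat :=
  count (fun e => if e is (Some a, Some b) then d + a == b %[mod n] else false) s.

(* Base blocks over [Z_n] and a fixed point [None]. *)
Definition starter_ok n t (s : seq (quad (option nat) nat)) : bool :=
  [&& all (fun q => uniq (map (omap (modn^~ n)) (entries q))) s,
   all (fun d => diff_count n d (all_leaf_pairs s) == 2) (iota 1 n.-1),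
   count (fun e => ~~ isSome e.1 && isSome e.2) (all_leaf_pairs s) == 2,
   count (fun e => isSome e.1 && ~~ isSome e.2) (all_leaf_pairs s) == 2,
   all (fun d => diff_count n d (all_inner_arcs s ++ map (@swap _) (all_inner_arcs s)) <= 1)
     (iota 1 n.-1),
   count (fun e => isSome e.1 (+) isSome e.2) (all_inner_arcs s) <= 1,
   all (fun e => isSome e.1 && (e.2 < t)) (all_outer_arcs s) &
   all (fun w => count (fun e => e.2 == w) (all_outer_arcs s) <= 3) (iota 0 t)].

Section Starter.
Variables (n t : nat) (n_gt1 : 1 < n) (s : seq (quad (option nat) nat)).
Let f (k : 'Z_n) : option nat -> option 'Z_n := omap (fun a => (a%:R + k)%R).
Let g (k : 'Z_n) : nat -> 'I_t.+1 := inord.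

(** A pair of residues is reached by one translation if its difference is right and by none
    otherwise; an orbit joining residues to the fixed point reaches each residue once. The case of
    two [None] is ruled out by [x != y]. *)
Lemma sum_starter (A : seq (option nat * option nat)) x y : x != y ->
  \sum_(k <- enum 'Z_n) \sum_(p <- A) ((f k p.1, f k p.2) == (x, y)) =
  match x, y with
  | Some x, Some y => diff_count n (y - x)%R A
  | Some _, None => count (fun e => isSome e.1 && ~~ isSome e.2) A
  | None, Some _ => count (fun e => ~~ isSome e.1 && isSome e.2) A
  | None, None => 0
  end.
Proof.
rewrite big_enum exchange_big /diff_count /=.
case: x y => [x|] [y|] // _; rewrite count_sum; apply: eq_bigr => -[[a|] [b|]] _ //=.
all: try (by rewrite big1 // => k _; rewrite xpair_eqE /= ?andbF).
- rewrite -sum_translation2 //; apply: eq_bigr => k _; by rewrite xpair_eqE.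
- rewrite -[RHS](sum_translation a x); apply: eq_bigr => k _; by rewrite xpair_eqE andbT.
- rewrite -[RHS](sum_translation b y); apply: eq_bigr => k _; by rewrite xpair_eqE.
Qed.

Lemma starter_nested : starter_ok n t.+1 s ->
  exists s' : seq (quad (option 'Z_n) 'I_t.+1), nested_system s'.
Proof.
case/and5P=> wf /allP prs /eqP prs01 /eqP prs10 /and4P[/allP inn innN /allP outb /allP out].
have xorE (A : seq (option nat * option nat)) :
    count (fun e => isSome e.1 && ~~ isSome e.2) A +
    count (fun e => ~~ isSome e.1 && isSome e.2) A =
    count (fun e => isSome e.1 (+) isSome e.2) A.
  by elim: A => //= -[[a|] [b|]] A <- /=; lia.
exists (develop f g (enum 'Z_n) s); split=> [|x y xy|x y xy|x w].
- apply: (wf_develop (A := predT) (h := omap (modn^~ n))); last first.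
    by apply: sub_all wf => q ->; rewrite all_predT.
  move=> k _ [a|] [b|] _ _ // ab; have {}ab := GRing.addIr k (Some_inj ab).
  by rewrite /= -!val_Zp_nat // ab.
- rewrite leaf_pairs_develop sum_starter //.
  case: x y xy => [x|] [y|] // xy; apply/eqP/prs/Zp_sub_range => //.
- rewrite !inner_arcs_develop !sum_starter //; last by rewrite eq_sym.
  case: x y xy => [x|] [y|] // xy.
  + have /inn := Zp_sub_range n_gt1 xy; rewrite /diff_count count_cat count_map.
    apply: leq_trans; rewrite leq_add2l leq_eqVlt; apply/orP; left; apply/eqP.
    by apply: eq_count => -[[a|] [b|]] //=; rewrite Zp_sub_swap.
  + by rewrite xorE.
  + by rewrite addnC xorE.
- rewrite outer_arcs_develop.
  (* The orbit of an outer arc meets each residue once, so the number of base arcs at [w] bounds the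
     count at [(x, w)]; the fixed point starts no outer arc. *)
  apply: leq_trans (out w _); last by rewrite mem_iota /=.
  rewrite exchange_big count_sum /= big_seq [X in _ <= X]big_seq leq_sum //.
  move=> [[a|] c] /outb //= ct.
  case: x => [x|]; last by rewrite big1.
  have [->|cw] := eqVneq c w; last first.
    rewrite big1 // => k _; rewrite xpair_eqE [X in _ && X](_ : _ = false) ?andbF //.
    by apply: contraNF cw => /eqP <-; rewrite inordK.
  rewrite -[leqRHS](sum_translation a x) big_enum leq_sum // => k _.
  by rewrite xpair_eqE -[_ == Some x]/((a%:R + k)%R == x); case: (_ == x); rewrite // leq_b1.
Qed.
End Starter.
(** * Self-orthogonal latin squares *)

(** [so_pair] says that [L] is orthogonal to its transpose. Idempotency keeps [L i j] away from [i]
    and [j] when these differ. *)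
Record self_orthogonal (S : finType) (L : S -> S -> S) : Prop := SelfOrthogonal {
  so_idem : idempotent_op L;
  so_row : forall i, injective (L i);
  so_col : forall j, injective (L^~ j);
  so_pair : injective (fun e : S * S => (L e.1 e.2, L e.2 e.1)) }.

Lemma sum_bij_pred1 (T : finType) (f : T -> T) (y : T) :
  injective f -> \sum_x (f x == y) = 1.
Proof.
move=> fi; rewrite (bigD1 (invF fi y)) //= f_invF eqxx big1 // => x.
by rewrite -(inj_eq fi) f_invF => /negPf->.
Qed.

(** * Position pairs in the quadruples of a self-orthogonal square *)

Section Quadruples.
Variables (S : finType) (L : S -> S -> S).
Hypothesis soL : self_orthogonal L.
Implicit Types (e : S * S) (u v i j : S).

(** Selects one orientation of each unordered pair of distinct groups. *)
Definition rank_lt e : bool := enum_rank e.1 < enum_rank e.2.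
Definition place e (P : nat) : S := nth e.1 [:: e.1; e.2; L e.1 e.2; L e.2 e.1] P.
Definition places (P Q : nat) u v : nat :=
  \sum_(e | rank_lt e) ((place e P == u) && (place e Q == v)).

Lemma placesC P Q u v : places P Q u v = places Q P v u.
Proof. by apply: eq_bigr => e _; rewrite andbC. Qed.

Lemma row_neq i j : i != j -> L i j != i.
Proof.
apply: contraNneq => ij; apply/eqP; apply: (@so_row _ _ soL i).
by rewrite ij (so_idem soL).
Qed.

Lemma col_neq i j : i != j -> L i j != j.
Proof.
apply: contraNneq => ij; apply/eqP; apply: (@so_col _ _ soL j).
by rewrite /= ij (so_idem soL).
Qed.

Lemma twist_neq i j : i != j -> L i j != L j i.
Proof.
apply: contraNneq => ij.
have [-> _] : (i, j) = (j, i) by apply: (so_pair soL); rewrite /= ij.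
by [].
Qed.

Lemma rank_lt_neq e : rank_lt e -> e.1 != e.2.
Proof. by apply: contraTneq => e12; rewrite /rank_lt e12 ltnn. Qed.

Lemma place_uniq e : rank_lt e -> uniq [:: e.1; e.2; L e.1 e.2; L e.2 e.1].
Proof.
move/rank_lt_neq => ne; have en : e.2 != e.1 by rewrite eq_sym.
rewrite /= !inE !negb_or ne twist_neq // ![_ == L _ _]eq_sym.
by rewrite !(row_neq, col_neq).
Qed.

Lemma place_eq e P Q : rank_lt e -> P < 4 -> Q < 4 -> (place e P == place e Q) = (P == Q).
Proof. by move=> /place_uniq Ue P4 Q4; rewrite nth_uniq. Qed.

(** Exchanging [i] and [j] swaps positions 0 with 1 and 2 with 3, so two position pairs related by
    this swap together run over all ordered pairs [(i, j)]. *)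
Lemma sum_rank_lt (F : S -> S -> nat) : (forall i, F i i = 0) ->
  \sum_(e | rank_lt e) F e.1 e.2 + \sum_(e | rank_lt e) F e.2 e.1 = \sum_e F e.1 e.2.
Proof.
move=> F0; rewrite [RHS](bigID rank_lt) /=; congr (_ + _).
rewrite (reindex_inj (h := fun e => (e.2, e.1))) /=; last by move=> [a b] [c d] [-> ->].
rewrite [LHS]big_mkcond [RHS]big_mkcond; apply: eq_bigr => -[i j] _; rewrite /rank_lt /=.
by case: (ltngtP (enum_rank i) (enum_rank j)) => [||/val_inj/enum_rank_inj ->]; rewrite ?F0.
Qed.

Lemma sum_pairs_pred1 (F : S -> S -> S) u v : (forall i, injective (F i)) ->
  \sum_e ((e.1 == u) && (F e.1 e.2 == v)) = 1.
Proof.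
move=> Fi; rewrite -(pair_bigA _ (fun i j => nat_of_bool ((i == u) && (F i j == v)))) /=.
rewrite (bigD1 u) //= eqxx /= [X in _ + X]big1 => [|i /negPf->]; last by rewrite big1.
by rewrite addn0 sum_bij_pred1.
Qed.

Section Distinct.
Variables (u v : S).
Hypothesis uv : u != v.

Lemma diag_false i : (i == u) && (i == v) = false.
Proof. by apply: contraNF uv => /andP[/eqP<- /eqP->]. Qed.

Lemma places01 : places 0 1 u v + places 1 0 u v = 1.
Proof.
apply: etrans _ (@sum_pairs_pred1 (fun _ j => j) u v (fun _ => @inj_id S)).
apply: (@sum_rank_lt (fun i j => (i == u) && (j == v))) => i.
by rewrite diag_false.
Qed.

Lemma places02 : places 0 2 u v + places 1 3 u v = 1.
Proof.
apply: etrans _ (@sum_pairs_pred1 L u v (so_row soL)).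
apply: (@sum_rank_lt (fun i j => (i == u) && (L i j == v))) => i.
by rewrite so_idem // diag_false.
Qed.

Lemma places03 : places 0 3 u v + places 1 2 u v = 1.
Proof.
apply: etrans _ (@sum_pairs_pred1 (fun i j => L j i) u v (so_col soL)).
apply: (@sum_rank_lt (fun i j => (i == u) && (L j i == v))) => i.
by rewrite so_idem // diag_false.
Qed.

Lemma places23 : places 2 3 u v + places 3 2 u v = 1.
Proof.
apply: etrans _ (sum_bij_pred1 (u, v) (so_pair soL)).
apply: etrans _ (@sum_rank_lt (fun i j => (L i j, L j i) == (u, v)) _) => [|i].
  by congr (_ + _); apply: eq_bigr => e _; rewrite xpair_eqE.
by rewrite xpair_eqE so_idem // diag_false.
Qed.

End Distinct.

Lemma places20 u v : u != v -> places 2 0 u v + places 3 1 u v = 1.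
Proof. by move=> uv; rewrite !(placesC _ _ u) places02 // eq_sym. Qed.

Lemma places30 u v : u != v -> places 3 0 u v + places 2 1 u v = 1.
Proof. by move=> uv; rewrite !(placesC _ _ u) places03 // eq_sym. Qed.

Lemma places_same P Q u : P < 4 -> Q < 4 -> P != Q -> places P Q u u = 0.
Proof.
move=> P4 Q4 PQ; rewrite /places big1 // => e lte; apply/eqP; rewrite eqb0.
by apply: contraNN PQ => /andP[/eqP eP /eqP eQ]; rewrite -(place_eq lte) // eP eQ.
Qed.

End Quadruples.

(** * Balanced lists and blocks across groups *)

(* Ordered so that consecutive position pairs are those which jointly cover each pair of groups
   once. *)
Definition off_diagonal : seq (nat * nat) :=
  [:: (0,1); (1,0); (2,3); (3,2); (0,2); (1,3); (2,0); (3,1); (0,3); (1,2); (3,0); (2,1)].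

(** If the two members of each of the six classes occur equally often, a class with multiplicity [m]
    gives [m] to every ordered pair of distinct groups, so each such pair is met [c] times in
    all. *)
Definition balanced (c : nat) (K : seq (nat * nat)) : bool :=
  let N P Q := count_mem (P, Q) K in
  [&& all [in off_diagonal] K,
      N 0 1 == N 1 0, N 2 3 == N 3 2, N 0 2 == N 1 3, N 2 0 == N 3 1,
      N 0 3 == N 1 2, N 3 0 == N 2 1 &
      N 0 1 + N 2 3 + N 0 2 + N 2 0 + N 0 3 + N 3 0 == c].

Lemma sum_count_mem (T : eqType) (s K : seq T) (F : T -> nat) :
  uniq s -> all [in s] K -> \sum_(x <- K) F x = \sum_(y <- s) count_mem y K * F y.
Proof.
move=> Us; elim: K => [|x K IH] /=; first by rewrite big_nil big1.
case/andP=> xs /IH IHK; rewrite big_cons IHK [RHS](bigD1_seq x) //=.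
rewrite eqxx mulnDl mul1n -addnA [in LHS](bigD1_seq x) //=; do 2!congr (_ + _).
by apply: eq_bigr => y /negPf; rewrite eq_sym => ->.
Qed.

Lemma sum_places_balanced (S : finType) (L : S -> S -> S) c K u v :
  self_orthogonal L -> balanced c K -> u != v ->
  \sum_(p <- K) places L p.1 p.2 u v = c.
Proof.
move=> soL /and5P[Koff /eqP e01 /eqP e23 /eqP e02 /and4P[/eqP e20 /eqP e03 /eqP e30 /eqP <-]] uv.
rewrite (sum_count_mem _ _ Koff) // !big_cons big_nil /= -e01 -e23 -e02 -e20 -e03 -e30.
have grp m a b r : a + b = 1 -> m * a + (m * b + r) = m + r.
  by move=> ab; rewrite addnA -mulnDr ab muln1.
rewrite !grp ?addnA ?addn0 //;
  first [exact: places01 | exact: places23 | exact: places02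
        | exact: places20 | exact: places03 | exact: places30].
Qed.

Lemma sum_places_same (S : finType) (L : S -> S -> S) c K u :
  self_orthogonal L -> balanced c K -> \sum_(p <- K) places L p.1 p.2 u u = 0.
Proof.
move=> soL /andP[/allP Koff _]; rewrite big_seq big1 // => p /Koff.
have /allP off : all (fun p => [&& p.1 < 4, p.2 < 4 & p.1 != p.2]) off_diagonal by [].
by case/off/and3P; apply: places_same.
Qed.

Definition diff_places g d (A : seq ((nat * nat) * (nat * nat))) : seq (nat * nat) :=
  [seq (e.1.1, e.2.1) | e <- A & d + e.1.2 == e.2.2 %[mod g]].

Lemma diff_places_cat g d A B : diff_places g d (A ++ B) = diff_places g d A ++ diff_places g d B.
Proof. by rewrite /diff_places filter_cat map_cat. Qed.

(* In a base block over [nat * nat], the first component is a position 0..3 in the quadruple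
   [(i, j, L i j, L j i)]; the second is a residue modulo [g], or the index of a new point. *)
Definition recipe_ok g t (R : seq (quad (nat * nat) (nat * nat))) : bool :=
  [&& all (fun q => all (fun p => p.1 < 4) (entries q) && uniq (map fst (entries q))) R,
   all (fun d => balanced 2 (diff_places g d (all_leaf_pairs R))) (iota 0 g),
   all (fun d => balanced 1
     (diff_places g d (all_inner_arcs R ++ map (@swap _) (all_inner_arcs R)))) (iota 0 g),
   all (fun e => e.2.2 < t) (all_outer_arcs R) &
   all (fun w => balanced 3 [seq (e.1.1, e.2.1) | e <- all_outer_arcs R & e.2.2 == w]) (iota 0 t)].

Lemma sum_fill (S : finType) (X W : eqType) (A : seq (X * W)) (u v : S) (x : X) (w : W) :
  \sum_(k <- enum S) \sum_(p <- A) (((k, p.1), (k, p.2)) == ((u, x), (v, w))) =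
  (u == v) * count_mem (x, w) A.
Proof.
rewrite big_enum (bigD1 u) //= [X in _ + X]big1 ?addn0 => [|k /negPf ku]; last first.
  by rewrite big1 // => p _; rewrite !xpair_eqE ku.
rewrite count_sum big_distrr; apply: eq_bigr => -[a b] _ /=.
by rewrite !xpair_eqE eqxx /= mulnb andbCA.
Qed.

Section Recipe.
Variables (S : finType) (L : S -> S -> S) (soL : self_orthogonal L).
Variables (g t : nat) (g_gt1 : 1 < g) (R : seq (quad (nat * nat) (nat * nat))).
Hypothesis R_ok : recipe_ok g t.+1 R.
Implicit Types (u v : S) (x y : 'Z_g).

Let ks : seq ((S * S) * 'Z_g) :=
  [seq (e, k) | e <- [seq e <- enum {: S * S} | rank_lt e], k <- enum 'Z_g].
Let f (k : (S * S) * 'Z_g) (p : nat * nat) : S * 'Z_g :=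
  (place L k.1 p.1, (p.2%:R + k.2)%R).
Let h (k : (S * S) * 'Z_g) (p : nat * nat) : S * 'I_t.+1 :=
  (place L k.1 p.1, inord p.2).

Lemma big_ks (F : (S * S) * 'Z_g -> nat) :
  \sum_(k <- ks) F k = \sum_(e | rank_lt e) \sum_(k : 'Z_g) F (e, k).
Proof.
rewrite /ks big_allpairs_dep big_filter big_enum_cond /=.
by apply: eq_bigr => e _; rewrite big_enum.
Qed.

(** The condition on groups involves only the quadruple and the condition on residues only the
    translation, so the sum factors; the second factor is 1 or 0 according to the difference. *)
Lemma sum_recipe_pairs (A : seq ((nat * nat) * (nat * nat))) u x v y :
  \sum_(k <- ks) \sum_(p <- A) ((f k p.1, f k p.2) == ((u, x), (v, y))) =
  \sum_(p <- diff_places g (y - x)%R A) places L p.1 p.2 u v.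
Proof.
rewrite big_ks /diff_places big_map big_filter [RHS]big_mkcond.
rewrite (eq_bigr (fun e => \sum_(p <- A) \sum_(k : 'Z_g)
  ((f (e, k) p.1, f (e, k) p.2) == ((u, x), (v, y))))) => [|e _]; last by rewrite exchange_big.
rewrite exchange_big /=; apply: eq_bigr => -[[P a] [Q b]] _ /=.
transitivity (\sum_(e | rank_lt e) ((place L e P == u) && (place L e Q == v)) *
    \sum_(k : 'Z_g) (((a%:R + k)%R == x) && ((b%:R + k)%R == y))).
  apply: eq_bigr => e _; rewrite big_distrr; apply: eq_bigr => k _ /=.
  by rewrite /f /= !xpair_eqE andbACA mulnb.
by rewrite -big_distrl /= sum_translation2 //; case: ifP => _; rewrite ?muln1 ?muln0.
Qed.

(** The sum factors as before, but a new point keeps its index under translation, so every residue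
    is reached once whatever the difference. *)
Lemma sum_recipe_outer (A : seq ((nat * nat) * (nat * nat))) u x v (w : 'I_t.+1) :
  all (fun e => e.2.2 < t.+1) A ->
  \sum_(k <- ks) \sum_(p <- A) ((f k p.1, h k p.2) == ((u, x), (v, w))) =
  \sum_(p <- [seq (e.1.1, e.2.1) | e <- A & e.2.2 == w :> nat]) places L p.1 p.2 u v.
Proof.
move=> /allP At; rewrite big_ks big_map big_filter [RHS]big_mkcond.
rewrite (eq_bigr (fun e => \sum_(p <- A) \sum_(k : 'Z_g)
  ((f (e, k) p.1, h (e, k) p.2) == ((u, x), (v, w))))) => [|e _]; last by rewrite exchange_big.
rewrite exchange_big /= big_seq [RHS]big_seq.
apply: eq_bigr => -[[P a] [Q c]] /At /= ct.
transitivity (\sum_(e | rank_lt e) ((place L e P == u) && (place L e Q == v)) *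
    ((c == w) * \sum_(k : 'Z_g) ((a%:R + k)%R == x))).
  apply: eq_bigr => e _; rewrite !big_distrr; apply: eq_bigr => k _ /=.
  rewrite /f /h /= !xpair_eqE andbACA !mulnb [(_ == x) && _]andbC.
  by rewrite -val_eqE /= inordK.
by rewrite -big_distrl /= sum_translation muln1; case: ifP => _; rewrite ?muln1 ?muln0.
Qed.

Lemma balanced_sum c K u v : balanced c K ->
  \sum_(p <- K) places L p.1 p.2 u v = (u != v) * c.
Proof.
move=> Kc; have [->|uv] := eqVneq u v; first exact: sum_places_same Kc.
by rewrite (sum_places_balanced soL Kc) ?mul1n.
Qed.

Lemma recipe_nested (s0 : seq (quad 'Z_g 'I_t.+1)) : nested_system s0 ->
  exists s : seq (quad (S * 'Z_g) (S * 'I_t.+1)), nested_system s.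
Proof.
case/and5P: R_ok => wf /allP prs /allP inn outb /allP out.
case=> wf0 prs0 inn0 out0.
(* The difference 0 is included, since points of distinct groups may have equal residues. *)
have range x : (x : nat) \in iota 0 g by rewrite mem_iota Zp_lt.
exists (develop pair pair (enum S) s0 ++ develop f h ks R); split.
- rewrite all_cat; apply/andP; split.
    apply: (wf_develop (A := predT) (h := id)) => [k _ x y _ _ [] //|].
    by apply: sub_all wf0 => q; rewrite wf_quadE map_id all_predT.
  (* Distinct positions lie in distinct groups, so the position alone separates the points of a
     block. *)
  apply: (wf_develop (A := fun p => p.1 < 4) (h := fst)) wf => -[e k].
  case/allpairsP=> -[e' k'] /= [e'_lt _ [ee' _]].
  move: e'_lt; rewrite -ee' mem_filter => /andP[lt_e _] [P a] [Q b] P4 Q4 [/eqP].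
  by rewrite (place_eq soL) // => /eqP.
- move=> [u x] [v y] uxvy; rewrite all_leaf_pairs_cat count_cat !leaf_pairs_develop.
  rewrite sum_fill sum_recipe_pairs (balanced_sum _ _ (prs _ (range _))).
  move: uxvy; rewrite xpair_eqE; case: eqVneq => //= _.
  by move=> /prs0 ->.
- move=> [u x] [v y] uxvy; rewrite all_inner_arcs_cat !count_cat !inner_arcs_develop.
  rewrite !sum_fill !sum_recipe_pairs.
  (* Reversed arcs are counted as swapped arcs, so that both directions form one balanced list. *)
  have -> : \sum_(p <- diff_places g (x - y)%R (all_inner_arcs R)) places L p.1 p.2 v u =
     \sum_(p <- diff_places g (y - x)%R (map (@swap _) (all_inner_arcs R))) places L p.1 p.2 u v.
    rewrite /diff_places filter_map -map_comp !big_map.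
    rewrite !big_filter; apply: eq_big => [[[P a] [Q b]]|[[P a] [Q b]] _] /=.
      by rewrite Zp_sub_swap.
    by rewrite placesC.
  rewrite addnACA -big_cat -diff_places_cat.
  rewrite (balanced_sum _ _ (inn _ (range _))).
  move: uxvy; rewrite xpair_eqE [v == u]eq_sym; case: eqVneq => //= _.
  by move=> /inn0; rewrite !mul1n addn0.
- move=> [u x] [v w]; rewrite all_outer_arcs_cat count_cat !outer_arcs_develop.
  rewrite sum_fill sum_recipe_outer // (balanced_sum _ _ (out w _)) ?mem_iota //=.
  by case: eqVneq => //= _; rewrite mul1n addn0.
Qed.

End Recipe.

(** * Base blocks *)

(** Counting the pairs across groups forces [4 t0] base blocks when [g = 6 t0]. Half are nested at
    old points; each new index nests two blocks, at positions 0 and 1, whose six arcs fill three of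
    the classes of [balanced]. *)
Definition recipe1 : seq (quad (nat * nat) (nat * nat)) :=
  [:: ((0, 5), (1, 2), (2, 3), inl (3, 0));
      ((0, 2), (1, 5), (3, 0), inl (2, 0));
      ((1, 0), (2, 4), (3, 4), inr (0, 0));
      ((0, 0), (2, 1), (3, 1), inr (1, 0))].

Definition recipe2 : seq (quad (nat * nat) (nat * nat)) :=
  [:: ((0, 5), (1, 2), (2, 3), inl (3, 0));
      ((0, 2), (1, 5), (3, 6), inl (2, 0));
      ((0, 11), (1, 8), (2, 0), inl (3, 0));
      ((0, 8), (1, 11), (3, 3), inl (2, 0));
      ((1, 9), (2, 7), (3, 7), inr (0, 0));
      ((0, 7), (2, 11), (3, 5), inr (1, 0));
      ((1, 8), (2, 3), (3, 3), inr (0, 1));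
      ((0, 1), (2, 8), (3, 2), inr (1, 1))].

Definition recipe3 : seq (quad (nat * nat) (nat * nat)) :=
  [:: ((0, 14), (1, 12), (2, 9), inl (3, 0));
      ((0, 12), (1, 14), (3, 0), inl (2, 0));
      ((1, 0), (2, 6), (3, 13), inr (0, 0));
      ((0, 0), (2, 4), (3, 15), inr (1, 0));
      ((0, 11), (1, 2), (2, 1), inl (3, 0));
      ((0, 2), (1, 11), (3, 10), inl (2, 0));
      ((1, 0), (2, 8), (3, 8), inr (0, 1));
      ((0, 0), (2, 17), (3, 17), inr (1, 1));
      ((0, 15), (1, 13), (2, 10), inl (3, 0));
      ((0, 13), (1, 15), (3, 1), inl (2, 0));
      ((1, 0), (2, 6), (3, 13), inr (0, 2));
      ((0, 0), (2, 4), (3, 15), inr (1, 2))].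

Definition recipe6 : seq (quad (nat * nat) (nat * nat)) :=
  [:: ((0, 27), (1, 7), (2, 0), inl (3, 0));
      ((0, 7), (1, 27), (3, 20), inl (2, 0));
      ((1, 0), (2, 6), (3, 9), inr (0, 0));
      ((0, 0), (2, 29), (3, 14), inr (1, 0));
      ((0, 26), (1, 11), (2, 21), inl (3, 0));
      ((0, 11), (1, 26), (3, 17), inl (2, 0));
      ((1, 0), (2, 6), (3, 31), inr (0, 1));
      ((0, 0), (2, 27), (3, 29), inr (1, 1));
      ((0, 28), (1, 3), (2, 20), inl (3, 0));
      ((0, 3), (1, 28), (3, 2), inl (2, 0));
      ((1, 0), (2, 13), (3, 28), inr (0, 2));
      ((0, 0), (2, 10), (3, 10), inr (1, 2));
      ((0, 4), (1, 24), (2, 2), inl (3, 0));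
      ((0, 24), (1, 4), (3, 21), inl (2, 0));
      ((1, 0), (2, 33), (3, 34), inr (0, 3));
      ((0, 0), (2, 17), (3, 17), inr (1, 3));
      ((0, 22), (1, 30), (2, 18), inl (3, 0));
      ((0, 30), (1, 22), (3, 35), inl (2, 0));
      ((1, 0), (2, 35), (3, 32), inr (0, 4));
      ((0, 0), (2, 13), (3, 24), inr (1, 4));
      ((0, 13), (1, 31), (2, 17), inl (3, 0));
      ((0, 31), (1, 13), (3, 1), inl (2, 0));
      ((1, 0), (2, 5), (3, 4), inr (0, 5));
      ((0, 0), (2, 24), (3, 22), inr (1, 5))].

(** There are [2 t0] base blocks over [Z_(6 t0 - 1)], only the first containing the fixed point.
    Half are nested at residue 0, which is translated along with the block. *)
Definition starter1 : seq (quad (option nat) nat) :=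
  [:: (None, Some 4, Some 2, inl (Some 0));
      (Some 0, Some 1, Some 2, inr 0)].

Definition starter2 : seq (quad (option nat) nat) :=
  [:: (None, Some 5, Some 3, inl (Some 0));
      (Some 4, Some 10, Some 9, inl (Some 0));
      (Some 0, Some 3, Some 7, inr 0);
      (Some 0, Some 1, Some 3, inr 1)].

Definition starter3 : seq (quad (option nat) nat) :=
  [:: (None, Some 7, Some 4, inl (Some 0));
      (Some 2, Some 16, Some 9, inl (Some 0));
      (Some 3, Some 11, Some 5, inl (Some 0));
      (Some 0, Some 2, Some 8, inr 0);
      (Some 0, Some 1, Some 5, inr 1);
      (Some 0, Some 1, Some 5, inr 2)].

Definition starter6 : seq (quad (option nat) nat) :=
  [:: (None, Some 8, Some 31, inl (Some 0));
      (Some 34, Some 14, Some 17, inl (Some 0));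
      (Some 16, Some 23, Some 2, inl (Some 0));
      (Some 15, Some 30, Some 22, inl (Some 0));
      (Some 32, Some 29, Some 10, inl (Some 0));
      (Some 9, Some 11, Some 28, inl (Some 0));
      (Some 0, Some 10, Some 22, inr 0);
      (Some 0, Some 2, Some 11, inr 1);
      (Some 0, Some 5, Some 11, inr 2);
      (Some 0, Some 1, Some 10, inr 3);
      (Some 0, Some 4, Some 8, inr 4);
      (Some 0, Some 1, Some 6, inr 5)].

Lemma starter1_ok : starter_ok 5 1 starter1. Proof. by vm_compute. Qed.
Lemma starter2_ok : starter_ok 11 2 starter2. Proof. by vm_compute. Qed.
Lemma starter3_ok : starter_ok 17 3 starter3. Proof. by vm_compute. Qed.
Lemma starter6_ok : starter_ok 35 6 starter6. Proof. by vm_compute. Qed.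

Lemma recipe1_ok : recipe_ok 6 1 recipe1. Proof. by vm_compute. Qed.
Lemma recipe2_ok : recipe_ok 12 2 recipe2. Proof. by vm_compute. Qed.
Lemma recipe3_ok : recipe_ok 18 3 recipe3. Proof. by vm_compute. Qed.
Lemma recipe6_ok : recipe_ok 36 6 recipe6. Proof. by vm_compute. Qed.

(** * Self-orthogonal squares from odd maps on abelian groups *)

Section OddMaps.
Import GRing.Theory.
Local Open Scope ring_scope.

(** With [d = i - j] the entry is [i - (d - f d)], which settles rows, while columns use [f] itself.
    Since [f] is odd, the entry minus its transpose is [2 f d - d]; this determines [d], and then
    the entry gives [j]. *)
Lemma self_orthogonal_odd (V : finZmodType) (f : V -> V) :
  f 0 = 0 -> (forall x, f (- x) = - f x) -> injective f -> injective (fun x => x - f x) ->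
  injective (fun x => f x *+ 2 - x) -> self_orthogonal (fun i j => j + f (i - j)).
Proof.
move=> f0 fN fI rI pI; split=> [i|i j j'|j i i'|[i j] [i' j'] /=].
- by rewrite subrr f0 addr0.
- have E k : k + f (i - k) = i - ((i - k) - f (i - k)).
    by rewrite opprB addrCA opprB [i + (k - i)]addrC subrK addrC.
  rewrite !E => /addrI/oppr_inj/rI/addrI/oppr_inj //.
- by move=> /addrI/fI/addIr.
- case=> e1 e2.
  have E k l : (l + f (k - l)) - (k + f (l - k)) = f (k - l) *+ 2 - (k - l).
    by rewrite -(opprB k l) fN !opprD !opprK mulr2n addrACA [l - k]addrC addrC [f _ + _ + _]addrC.
  have /pI d : f (i - j) *+ 2 - (i - j) = f (i' - j') *+ 2 - (i' - j') by rewrite -!E e1 e2.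
  by move: e1; rewrite d => /addIr jj; move: d; rewrite jj => /addIr->.
Qed.

Lemma mulrn_Zp_inj m k : (1 < m)%N -> coprime m k -> injective (fun x : 'Z_m => x *+ k).
Proof.
move=> m1 mk x y /= xy; have Uk : (k%:R : 'Z_m) \is a GRing.unit by rewrite unitZpE.
by apply: (mulIr Uk); rewrite !mulr_natr.
Qed.

(** For doubling, the three maps are multiplication by 2, -1 and 3. *)
Lemma self_orthogonal_Zp m : (1 < m)%N -> coprime m 6 ->
  exists L : 'Z_m -> 'Z_m -> 'Z_m, self_orthogonal L.
Proof.
move=> m1; rewrite -[6%N]/(2 * 3)%N coprimeMr => /andP[m2 m3].
exists (fun i j => j + (i - j) *+ 2).
apply: (self_orthogonal_odd (f := fun x => x *+ 2)) => [|x|||].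
- exact: mul0rn.
- exact: mulNrn.
- exact: mulrn_Zp_inj.
- by move=> x y /=; rewrite !mulr2n !opprD !addNKr => /oppr_inj.
- have E (z : 'Z_m) : z *+ 2 *+ 2 - z = z *+ 3 by ring.
  by move=> x y /=; rewrite !E; exact: mulrn_Zp_inj.
Qed.

HB.instance Definition _ (U V : finZmodType) := GRing.Zmodule.on (U * V)%type.

(* Multiplication by a generator of GF(4), as a matrix over GF(2). *)
Lemma self_orthogonal4 :
  exists L : 'Z_2 * 'Z_2 -> 'Z_2 * 'Z_2 -> 'Z_2 * 'Z_2, self_orthogonal L.
Proof.
pose f (x : 'Z_2 * 'Z_2) := (x.2, x.1 + x.2).
exists (fun i j => j + f (i - j)); apply: (self_orthogonal_odd (f := f)).
- by rewrite /f /= addr0.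
- by move=> x; rewrite /f /= -opprD.
- move=> [a b] [c d] E; have /= bd := congr1 fst E; have /= := congr1 snd E.
  by rewrite bd => /addIr->.
- move=> [a b] [c d] E; have /= e1 := congr1 fst E; have /= e2 := congr1 snd E.
  have ac : a = c.
    have -> : a = - (b - (a + b)) by ring.
    by rewrite e2; ring.
  by move: e1; rewrite ac => /addrI/oppr_inj->.
- move=> [a b] [c d] E; have /= e1 := congr1 fst E; have /= e2 := congr1 snd E.
  (* Over the integers the matrix of [2 f - 1] has determinant -5, and 5 is invertible modulo 2. *)
  have /(mulrn_Zp_inj (isT : (1 < 2)%N) (isT : coprime 2 5)) ac : a *+ 5 = c *+ 5.
    have -> : a *+ 5 = ((a + b) *+ 2 - b) *+ 2 - (b *+ 2 - a) by ring.
    by rewrite e1 e2; ring.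
  have -> : b = (a + b) *+ 2 - b - a *+ 2 by ring.
  have -> : d = (c + d) *+ 2 - d - c *+ 2 by ring.
  by rewrite e2 ac.
Qed.

(* Multiplication by a square root of -1 in GF(9). *)
Lemma self_orthogonal9 :
  exists L : 'Z_3 * 'Z_3 -> 'Z_3 * 'Z_3 -> 'Z_3 * 'Z_3, self_orthogonal L.
Proof.
pose f (x : 'Z_3 * 'Z_3) := (- x.2, x.1).
exists (fun i j => j + f (i - j)); apply: (self_orthogonal_odd (f := f)).
- by rewrite /f /= oppr0.
- by [].
- move=> [a b] [c d] E; have /= /oppr_inj bd := congr1 fst E; have /= -> := congr1 snd E.
  by rewrite bd.
- move=> [a b] [c d] E; have /= e1 := congr1 fst E; have /= e2 := congr1 snd E.
  (* Over the integers [1 - f] and [2 f - 1] have determinants 2 and 5, both prime to 3. *)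
  have /(mulrn_Zp_inj (isT : (1 < 3)%N) (isT : coprime 3 2)) bd : b *+ 2 = d *+ 2.
    have -> : b *+ 2 = (a - - b) + (b - a) by ring.
    by rewrite e1 e2; ring.
  by move: e1; rewrite bd => /addIr->.
- move=> [a b] [c d] E; have /= e1 := congr1 fst E; have /= e2 := congr1 snd E.
  have /(mulrn_Zp_inj (isT : (1 < 3)%N) (isT : coprime 3 5)) ac : a *+ 5 = c *+ 5.
    have -> : a *+ 5 = (a *+ 2 - b) *+ 2 - (- b *+ 2 - a) by ring.
    by rewrite e1 e2; ring.
  by move: e2; rewrite ac => /addrI/oppr_inj->.
Qed.

End OddMaps.

(** * Products and orders of self-orthogonal squares *)

Lemma self_orthogonal_unit : self_orthogonal (fun _ _ : unit => tt).
Proof. by split=> // [[]|[] [] []|[] [] []|[[] []] [[] []]]. Qed.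

Lemma self_orthogonal_prod (S T : finType) (L : S -> S -> S) (M : T -> T -> T) :
  self_orthogonal L -> self_orthogonal M ->
  self_orthogonal (fun x y : S * T => (L x.1 y.1, M x.2 y.2)).
Proof.
move=> soL soM; split=> [[i i']|[i i'] [j j'] [k k']|[j j'] [i i'] [k k']|] /=.
- by rewrite (so_idem soL) (so_idem soM).
- by case=> /(so_row soL)-> /(so_row soM)->.
- by case=> /(@so_col _ _ soL j)-> /(@so_col _ _ soM j')->.
- move=> [[i i'] [j j']] [[k k'] [l l']] /= [e1 e2 e3 e4].
  have [-> ->] : (i, j) = (k, l) by apply: (so_pair soL); rewrite /= e1 e3.
  by have [-> ->] : (i', j') = (k', l') by apply: (so_pair soM); rewrite /= e2 e4.
Qed.

Definition has_self_orthogonal s : Prop :=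
  exists (S : finType) (L : S -> S -> S), #|S| = s /\ self_orthogonal L.

Lemma has_self_orthogonalM m n :
  has_self_orthogonal m -> has_self_orthogonal n -> has_self_orthogonal (m * n).
Proof.
move=> [S [L [<- soL]]] [T [M [<- soM]]].
by exists (S * T)%type, (fun x y => (L x.1 y.1, M x.2 y.2)); rewrite card_prod; split=> //;
   apply: self_orthogonal_prod.
Qed.

Lemma card_Zp m : 1 < m -> #|'Z_m| = m.
Proof. by move=> m1; rewrite card_ord Zp_cast. Qed.

Lemma has_self_orthogonal4 : has_self_orthogonal 4.
Proof. by have [L soL] := self_orthogonal4; exists _, L; rewrite card_prod !card_Zp. Qed.

Lemma has_self_orthogonal9 : has_self_orthogonal 9.
Proof. by have [L soL] := self_orthogonal9; exists _, L; rewrite card_prod !card_Zp. Qed.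

Lemma has_self_orthogonal_coprime6 m : 0 < m -> coprime m 6 -> has_self_orthogonal m.
Proof.
case: m => [|[|m]] // _ m6.
  (* ['Z_1] has two elements, so order 1 is realised on [unit]. *)
  by exists unit, (fun _ _ => tt); rewrite card_unit; split=> //; exact: self_orthogonal_unit.
by have [L soL] := self_orthogonal_Zp (isT : 1 < m.+2) m6; exists _, L; rewrite card_Zp.
Qed.

(* [t0] is at most 6 because 4 and 9 are themselves orders of self-orthogonal squares. *)
Lemma self_orthogonal_decomposition t : 0 < t ->
  exists t0 s, [/\ t0 \in [:: 1; 2; 3; 6], has_self_orthogonal s & t = t0 * s].
Proof.
elim/ltn_ind: t => t IH t_gt0.
have step n : 1 < n -> has_self_orthogonal n -> n %| t ->
    exists t0 s, [/\ t0 \in [:: 1; 2; 3; 6], has_self_orthogonal s & t = t0 * s].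
  move=> n1 son /dvdnP[k tE]; have k_gt0 : 0 < k by case: k tE t_gt0 => // ->.
  have [|t0 [s [t0P sos kE]]] := IH k _ k_gt0; first by rewrite tE ltn_Pmulr.
  by exists t0, (s * n); split=> //; [exact: has_self_orthogonalM | rewrite tE kE mulnA].
have [/step|n4] := boolP (4 %| t); first by apply; [|exact: has_self_orthogonal4].
have [/step|n9] := boolP (9 %| t); first by apply; [|exact: has_self_orthogonal9].
(* With neither 4 nor 9 dividing [t], the part of [t] built from 2 and 3 divides 6 and is split off
   as [t0]. *)
have [t0 t0P [s tE s6]] : exists2 t0, t0 \in [:: 1; 2; 3; 6] & exists2 s, t = t0 * s & coprime s 6.
  have cop s : ~~ (2 %| s) -> ~~ (3 %| s) -> coprime s 6.
    by move=> s2 s3; rewrite -[6]/(2 * 3) coprimeMr ![coprime s _]coprime_sym !prime_coprime ?s2.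
  have [/dvdnP[a aE]|t2] := boolP (2 %| t); have [/dvdnP[b bE]|t3] := boolP (3 %| t).
  - exists 6 => //; exists (t %/ 6); first by lia.
    by apply: cop; lia.
  - by exists 2 => //; exists a; [lia | apply: cop; lia].
  - by exists 3 => //; exists b; [lia | apply: cop; lia].
  - by exists 1 => //; exists t; [lia | exact: cop].
exists t0, s; split=> //; apply: has_self_orthogonal_coprime6 => //.
by case: s tE {s6} t_gt0 => // ->; rewrite muln0.
Qed.


(** * Existence and optimality *)

Lemma card_eq_bijective (A B : finType) : #|A| = #|B| -> exists f : A -> B, bijective f.
Proof.
move=> AB; exists (fun x => enum_val (cast_ord AB (enum_rank x))).
exists (fun y => enum_val (cast_ord (esym AB) (enum_rank y))) => x.
  by rewrite enum_valK cast_ordK enum_rankK.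
by rewrite enum_valK cast_ordKV enum_rankK.
Qed.

Definition has_nested_system t : Prop :=
  exists (X W : finType) (s : seq (quad X W)), [/\ #|X| = 6 * t, #|W| = t & nested_system s].

(** The starter lives on [Z_n] with a fixed point, the recipe on [Z_(n + 1)]. Any bijection between
    them will do, since the filling of a group need not respect addition. *)
Lemma has_nested_systemM n t ns r s :
  1 < n -> n.+1 = 6 * t.+1 -> starter_ok n t.+1 ns -> recipe_ok (6 * t.+1) t.+1 r ->
  has_self_orthogonal s -> has_nested_system (t.+1 * s).
Proof.
move=> n1 nE ns_ok r_ok [S [L [<- soL]]]; have g1 : 1 < 6 * t.+1 by lia.
have [s0 s0_nested] := starter_nested n1 ns_ok.
have [f f_bij] : exists f : option 'Z_n -> 'Z_(6 * t.+1), bijective f.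
  by apply: card_eq_bijective; rewrite card_option !card_Zp.
have id_bij : bijective (@id 'I_t.+1) by exists id.
have [s1 s1_nested] := recipe_nested soL g1 r_ok
  (nested_system_transfer f_bij id_bij s0_nested).
exists (S * 'Z_(6 * t.+1))%type, (S * 'I_t.+1)%type, s1.
by rewrite !card_prod card_Zp // card_ord; split=> //; lia.
Qed.

Lemma has_nested_system_pos t : 0 < t -> has_nested_system t.
Proof.
move=> /self_orthogonal_decomposition[t0 [s [t0P sos ->]]].
move: t0P; rewrite !inE => /or4P[] /eqP->.
- exact: has_nested_systemM starter1_ok recipe1_ok sos.
- exact: has_nested_systemM starter2_ok recipe2_ok sos.
- exact: has_nested_systemM starter3_ok recipe3_ok sos.
- exact: has_nested_systemM starter6_ok recipe6_ok sos.
Qed.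

(** * From quadruples to sets of points *)

Lemma mem_leaves_pairs (X : eqType) W (q : quad X W) x y : wf_quad q -> x != y ->
  (x \in leaves q) && (y \in leaves q) = count_mem (x, y) (leaf_pairs q) :> nat.
Proof.
case: q => [[[a b] c] d] /andP[+ _]; rewrite /leaves /= !inE !xpair_eqE.
rewrite ![_ == a]eq_sym ![_ == b]eq_sym ![_ == c]eq_sym.
rewrite !negb_or andbT => /andP[/andP[ab ac] bc] xy.
have ex (z u v : X) : u != v -> ~~ ((u == z) && (v == z)).
  by apply: contraNN => /andP[/eqP-> /eqP->].
have ex' (z : X) : ~~ ((z == x) && (z == y)) by apply: contraNN xy => /andP[/eqP<- /eqP->].
move: (ex x _ _ ab) (ex x _ _ ac) (ex x _ _ bc).
move: (ex y _ _ ab) (ex y _ _ ac) (ex y _ _ bc) (ex' a) (ex' b) (ex' c).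
by case: (a == x) (b == x) (c == x) (a == y) (b == y) (c == y) => [] [] [] [] [] [].
Qed.

Lemma count_arcs (X Y : eqType) (l : seq X) (z : Y) x y : uniq l ->
  count_mem (x, y) [seq (a, z) | a <- l] = (z == y) && (x \in l).
Proof.
move=> Ul; rewrite count_map; have [->|zy] := eqVneq z y.
  by rewrite -count_uniq_mem //; apply: eq_count => a; rewrite /= xpair_eqE eqxx andbT.
by rewrite (eq_count (a2 := pred0)) ?count_pred0 // => a; rewrite /= xpair_eqE (negPf zy) andbF.
Qed.

Definition points X W (q : quad X W) : seq (X + W) := q.2 :: map inl (leaves q).

Lemma mem_inl (X W : eqType) (l : seq X) x : ((inl x : X + W) \in map inl l) = (x \in l).
Proof. by rewrite mem_map // => a b []. Qed.

Lemma mem_inr (X W : eqType) (l : seq X) (w : W) : (inr w \in map inl l) = false.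
Proof. by apply/negP => /mapP[]. Qed.

(** Either both points are leaves, or one is a leaf and the other the nesting point; distinctness
    makes these cases exclusive. *)
Lemma mem_points_inner (X W : eqType) (q : quad X W) x y : wf_quad q -> x != y ->
  (inl x \in points q) && (inl y \in points q) =
  count_mem (x, y) (leaf_pairs q) +
  (count_mem (x, y) (inner_arcs q) + count_mem (y, x) (inner_arcs q)) :> nat.
Proof.
move=> wf xy; rewrite -mem_leaves_pairs // /points /inner_arcs; move: wf; rewrite /wf_quad.
move: (leaves q) => l; rewrite !inE !mem_inl; case: (q.2) => [z|w] /andP[Ul zl] /=;
  last by rewrite !addn0.
rewrite !count_arcs // -!(inj_eq (@inl_inj X W)) ![_ == inl z]eq_sym.
have nx : ~~ ((z == x) && (x \in l)) by apply: contraNN zl => /andP[/eqP->].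
have ny : ~~ ((z == y) && (y \in l)) by apply: contraNN zl => /andP[/eqP->].
have nxy : ~~ ((z == x) && (z == y)) by apply: contraNN xy => /andP[/eqP<- /eqP->].
move: nx ny nxy; rewrite !(inj_eq (@inl_inj X W)).
by case: (z == x) (z == y) (x \in l) (y \in l) => [] [] [] [].
Qed.

Lemma mem_points_outer (X W : eqType) (q : quad X W) x w : wf_quad q ->
  (inl x \in points q) && (inr w \in points q) = count_mem (x, w) (outer_arcs q) :> nat.
Proof.
rewrite /wf_quad /points /outer_arcs; move: (leaves q) => l.
rewrite !inE mem_inl mem_inr orbF.
by case: (q.2) => [z|w'] /andP[Ul _] /=; rewrite ?andbF // count_arcs // andbC eq_sym.
Qed.

Lemma mem_points_inr (X W : eqType) (q : quad X W) (w w' : W) : w != w' ->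
  (inr w \in points q) && (inr w' \in points q) = false.
Proof.
rewrite /points; move: (leaves q) => l; rewrite !inE !mem_inr !orbF => ww'.
by apply: contraNF ww' => /andP[/eqP<-] /eqP[->].
Qed.

Lemma points_uniq (X W : eqType) (q : quad X W) : wf_quad q -> uniq (points q).
Proof.
rewrite /wf_quad /points; move: (leaves q) => l /andP[Ul dl].
rewrite cons_uniq; apply/andP; split; last by rewrite map_inj_uniq //; exact: inl_inj.
by case: (q.2) dl => [y|w] yl; rewrite ?mem_inl ?mem_inr.
Qed.

Lemma has_nested_system_weak_nesting t : has_nested_system t ->
  exists (b : nat) (B : 'I_b -> {set 'I_(7 * t)}) (X : {set 'I_(7 * t)})
         (phi : 'I_b -> 'I_(7 * t)),
    is_BIBD X (6 * t) 3 2 B /\ weak_nesting X [set: 'I_(7 * t)] 3 2 B phi.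
Proof.
move=> [X [W [s [cardX cardW [wf prs inn out]]]]].
have [f [f' fK f'K]] : exists f : X + W -> 'I_(7 * t), bijective f.
  by apply: card_eq_bijective; rewrite card_sum card_ord cardX cardW; lia.
pose q i := tnth (in_tuple s) i.
pose B i := [set z | f' z \in map inl (leaves (q i))].
pose phi i := f (q i).2.
have wfq : forall i, wf_quad (q i) by apply/all_tnthP.
have card_preim (l : seq (X + W)) : uniq l -> #|[set z | f' z \in l]| = size l.
  move=> Ul; rewrite -(card_uniqP Ul) -(card_imset _ (can_inj fK)); apply: eq_card => z.
  by rewrite inE -[z in RHS]f'K mem_imset //; exact: can_inj fK.
have BphiE i : B i :|: [set phi i] = [set z | f' z \in points (q i)].
  apply/setP=> z; rewrite /B /phi /points; move: (map inl _) => l.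
  by rewrite !inE orbC -(can_eq f'K) fK.
(* [C] is kept general to serve both the blocks and their augmentations. *)
have count_pairs (C : quad X W -> seq (X + W)) z w :
    pair_count (fun i => [set z | f' z \in C (q i)]) z w =
    \sum_(i < size s) ((f' z \in C (q i)) && (f' w \in C (q i))).
  rewrite /pair_count -sum1_card big_mkcond; apply: eq_bigr => i _.
  by rewrite !inE; case: (_ && _).
have sum_leaf e : \sum_(i < size s) count_mem e (leaf_pairs (q i)) =
    count_mem e (all_leaf_pairs s).
  by rewrite count_flatten_map [RHS]big_tnth.
have sum_inner e : \sum_(i < size s) count_mem e (inner_arcs (q i)) =
    count_mem e (all_inner_arcs s).
  by rewrite count_flatten_map [RHS]big_tnth.
have sum_outer e : \sum_(i < size s) count_mem e (outer_arcs (q i)) =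
    count_mem e (all_outer_arcs s).
  by rewrite count_flatten_map [RHS]big_tnth.
have inl_uniq (l : seq X) : uniq l -> uniq (map (@inl X W) l).
  by move=> Ul; rewrite map_inj_uniq //; exact: inl_inj.
exists (size s), B, [set z | f' z \in map inl (enum X)], phi; split; split.
- by rewrite card_preim ?inl_uniq ?enum_uniq // size_map -cardE.
- move=> i; split.
    by apply/subsetP => z; rewrite !in_set => /mapP[x _ ->]; rewrite mem_inl mem_enum.
  by rewrite card_preim ?inl_uniq //; case/andP: (wfq i).
- move=> z w; rewrite !in_set => /mapP[x _ zx] /mapP[y _ wy] zw.
  have xy : x != y by apply: contra zw => /eqP xy; rewrite -(can_eq f'K) zx wy xy.
  rewrite (count_pairs (fun q => map inl (leaves q))) -[RHS](prs x y xy) -sum_leaf.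
  by apply: eq_bigr => i _; rewrite zx wy !mem_inl mem_leaves_pairs.
- exact: subsetT.
- by move=> i; rewrite inE.
- move=> i; have := points_uniq (wfq i); rewrite /points /B /phi; move: (map inl _) => l.
  by rewrite !inE fK => /andP[].
split=> // [i|z w _ _ zw]; first by rewrite subsetT BphiE card_preim ?points_uniq.
have -> : pair_count (fun i => B i :|: [set phi i]) z w =
    \sum_(i < size s) ((f' z \in points (q i)) && (f' w \in points (q i))).
  by rewrite -count_pairs /pair_count; apply: eq_card => i;
    rewrite [in LHS]in_set [in RHS]in_set !BphiE.
have {zw} : f' z != f' w by rewrite (can_eq f'K).
have outer_le x (v : W) :
    \sum_(i < size s) ((inl x \in points (q i)) && (inr v \in points (q i))) <= 3.
  rewrite (leq_trans _ (out x v)) // -sum_outer leq_sum // => i _.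
  by rewrite mem_points_outer.
case: (f' z) (f' w) => [x|v] [y|v'] zw.
- have xy : x != y by apply: contra zw => /eqP->.
  rewrite (eq_bigr _ (fun i _ => mem_points_inner (wfq i) xy)) !big_split /=.
  by rewrite sum_leaf !sum_inner prs // -[3]/(2 + 1) leq_add2l inn.
- exact: outer_le.
- by under eq_bigr do rewrite andbC; exact: outer_le.
- have vv : v != v' by apply: contra zw => /eqP->.
  by rewrite big1 // => i _; rewrite mem_points_inr.
Qed.

(** * Double counting and the lower bound *)

Section DoubleCounting.
Variables (T : finType) (b : nat) (B : 'I_b -> {set T}).

(** Both sides count triples [(x, y, i)] with [x] in [P], [y] in [Q] and both in [B i]. *)
Lemma sum_pair_count (P Q : {set T}) :
  \sum_(x in P) \sum_(y in Q) pair_count B x y = \sum_i #|B i :&: P| * #|B i :&: Q|.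
Proof.
have cardE i (R : {set T}) : #|B i :&: R| = \sum_(x in R) (x \in B i).
  by rewrite -sum1_card -big_mkcondr; apply: eq_bigl => x; rewrite inE andbC.
under [RHS]eq_bigr => i _ do rewrite !cardE big_distrl.
rewrite [RHS]exchange_big; apply: eq_bigr => x _.
under [RHS]eq_bigr => i _ do rewrite big_distrr.
rewrite [RHS]exchange_big; apply: eq_bigr => y _.
rewrite /pair_count -sum1_card big_mkcond; apply: eq_bigr => i _.
by rewrite inE /= mulnb; case: (_ && _).
Qed.

Lemma sum_pair_count_diag (P : {set T}) :
  \sum_(x in P) pair_count B x x = \sum_i #|B i :&: P|.
Proof.
rewrite (eq_bigr (fun x => \sum_i (x \in B i))) => [|x _]; last first.
  rewrite /pair_count -sum1_card big_mkcond; apply: eq_bigr => i _.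
  by rewrite inE andbb; case: (_ \in _).
rewrite exchange_big; apply: eq_bigr => i _.
by rewrite -sum1_card -big_mkcondr; apply: eq_bigl => x; rewrite inE andbC.
Qed.

Lemma sum_pair_count_split (P : {set T}) :
  \sum_(x in P) \sum_(y in P) pair_count B x y =
  \sum_i #|B i :&: P| + \sum_(x in P) \sum_(y in P | y != x) pair_count B x y.
Proof.
rewrite -sum_pair_count_diag -big_split; apply: eq_bigr => x xP.
by rewrite (bigD1 x).
Qed.

End DoubleCounting.

Lemma weak_nesting_card (t : nat) (T : finType) (X Y : {set T}) (b : nat)
    (B : 'I_b -> {set T}) (phi : 'I_b -> T) : 0 < t ->
  is_BIBD X (6 * t) 3 2 B -> weak_nesting X Y 3 2 B phi -> 7 * t <= #|Y|.
Proof.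
move=> t_gt0 [cardX Bsub Bpairs] [XY phiY phiB [_ Csub Cpairs]].
pose C i := B i :|: [set phi i]; pose m := \sum_i (phi i \in X).
have others x : x \in X -> #|[set y in X | y != x]| = #|X|.-1.
  move=> xX; rewrite (cardsD1 x X) xX; apply: eq_card => y.
  by rewrite !inE andbC.
have BX i : #|B i :&: X| = 3 by have [/setIidPl-> ->] := Bsub i.
have CX i : #|C i :&: X| = 3 + (phi i \in X).
  rewrite /C setIUl cardsU BX; have [phiX|phiX] := boolP (phi i \in X).
    have -> : [set phi i] :&: X = [set phi i] by apply/setIidPl; rewrite sub1set.
    rewrite cards1 [X in _ - X](_ : _ = 0) ?subn0 //; apply/eqP; rewrite cards_eq0 -subset0.
    by apply/subsetP => z; rewrite !inE => /andP[/andP[zB _] /eqP zp];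
      rewrite zp (negPf (phiB i)) in zB.
  have -> : [set phi i] :&: X = set0.
    by apply/setP => z; rewrite !inE; apply: contraNF phiX => /andP[/eqP<-].
  by rewrite setI0 cards0.
have CYX i : #|C i :&: (Y :\: X)| = 1 - (phi i \in X).
  have [CY C4] := Csub i; have := cardsID X (C i); rewrite CX C4.
  have -> : C i :&: (Y :\: X) = C i :\: X by rewrite setIDA (setIidPl CY).
  by lia.
(* Each block has 9 ordered pairs, 3 of them diagonal. *)
have bE : 6 * b = 6 * t * ((6 * t).-1 * 2).
  have := sum_pair_count_split B X; rewrite sum_pair_count.
  under eq_bigr do rewrite BX.
  under [X in _ = X + _]eq_bigr do rewrite BX.
  have -> : \sum_(x in X) \sum_(y in X | y != x) pair_count B x y = 6 * t * ((6 * t).-1 * 2).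
    rewrite -cardX -sum_nat_const; apply: eq_bigr => x xX.
    rewrite -[in RHS](others x xX) -sum_nat_const
      [RHS](eq_bigl (fun y => (y \in X) && (y != x))) => [|y]; last by rewrite inE.
    by apply: eq_bigr => y /andP[yX yx]; rewrite Bpairs // eq_sym.
  by rewrite !sum_nat_const !card_ord; lia.
(* A block nested inside [X] has 16 - 4 = 12 ordered pairs in [X] off the diagonal, any other 9 - 3
   = 6. *)
have inner : 6 * b + 6 * m <= 6 * t * ((6 * t).-1 * 3).
  have := sum_pair_count_split C X; rewrite sum_pair_count.
  have le : \sum_(x in X) \sum_(y in X | y != x) pair_count C x y <= 6 * t * ((6 * t).-1 * 3).
    rewrite -cardX -sum_nat_const; apply: leq_sum => x xX.
    rewrite -[in leqRHS](others x xX) -sum_nat_const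
      [leqRHS](eq_bigl (fun y => (y \in X) && (y != x))) => [|y]; last by rewrite inE.
    by apply: leq_sum => y /andP[yX yx]; rewrite Cpairs ?(subsetP XY) // eq_sym.
  have -> : \sum_i #|C i :&: X| * #|C i :&: X| = 9 * b + 7 * m.
    rewrite -[b in RHS]card_ord -sum1_card !big_distrr -big_split; apply: eq_bigr => i _.
    by rewrite CX; case: (_ \in _).
  have -> : \sum_i #|C i :&: X| = 3 * b + m.
    rewrite -[b in RHS]card_ord -sum1_card !big_distrr -big_split; apply: eq_bigr => i _.
    by rewrite CX; case: (_ \in _).
  by lia.
(* Only blocks nested outside [X] have pairs between [X] and its complement in [Y], three each, and
   every such pair has capacity 3. *)
have outer : 3 * b <= 3 * m + 6 * t * ((#|Y| - 6 * t) * 3).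
  have -> : 3 * b = 3 * m + \sum_i #|C i :&: X| * #|C i :&: (Y :\: X)|.
    rewrite -[b in LHS]card_ord -sum1_card !big_distrr -big_split; apply: eq_bigr => i _.
    by rewrite CX CYX; case: (_ \in _).
  have -> : #|Y| - 6 * t = #|Y :\: X| by rewrite cardsD (setIidPr XY) cardX.
  rewrite leq_add2l -sum_pair_count -cardX -!sum_nat_const; apply: leq_sum => x xX.
  apply: leq_sum => y; rewrite inE => /andP[yX yY]; rewrite Cpairs ?(subsetP XY x) //.
  by apply: contraNneq yX => <-.
(* [inner] with [bE] gives [m <= t (6 t - 1)], which is put into twice [outer]. *)
have : 6 * t * (6 * t).-1 <= 6 * t * ((#|Y| - 6 * t) * 6) by lia.
(* By integrality [6 t - 1 <= 6 (#|Y| - 6 t)] rounds up to [t <= #|Y| - 6 t]. *)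
rewrite leq_pmul2l; lia.
Qed.

Theorem theorem3p4 (t : nat) :
  1 <= t -> t != 3 -> t != 6 ->
  (exists (b : nat) (B : 'I_b -> {set 'I_(7 * t)}) (X : {set 'I_(7 * t)})
          (phi : 'I_b -> 'I_(7 * t)),
      is_BIBD X (6 * t) 3 2 B /\
      weak_nesting X [set: 'I_(7 * t)] 3 2 B phi)
  /\
  (forall (T : finType) (X Y : {set T}) (b : nat) (B : 'I_b -> {set T})
          (phi : 'I_b -> T),
      is_BIBD X (6 * t) 3 2 B -> weak_nesting X Y 3 2 B phi ->
      7 * t <= #|Y|).
Proof.
move=> t_gt0 _ _; split; last by move=> T X Y b B phi; exact: weak_nesting_card.
by apply/has_nested_system_weak_nesting/has_nested_system_pos.
Qed.
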